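(* Let $G$ be a disconnected graph all of whose components are isomorphic to a connected graph $H$, and suppose that all edge-cards $H-e$ ($e\in E(H)$) are isomorphic. Suppose also that the minimum degree satisfies $\delta(H)\ge 3$. Then $dern(G)\le 2$.
   Context: All graphs are finite, simple and undirected. An edge-card of a graph is an edge-deleted subgraph $G-e$, considered up to isomorphism. For an edge $e=uv$, $d(e)=d(u)+d(v)-2$. A da-ecard of $G$ is a pair $(G-e,d(e))$; the da-edeck is the multiset of all da-ecards. $dern(G)$ is the minimum $k$ such that some multiset of $k$ da-ecards of $G$ is not contained in the da-edeck of any graph not isomorphic to $G$. *)

(* Defs.v *)
From mathcomp Require Import all_boot.

Set Implicit Arguments.
Unset Strict Implicit.
Unset Printing Implicit Defensive.

Record sgraph := SGraph {
  vertex :> finType;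
  adj : rel vertex;
  adj_sym : symmetric adj;
  adj_irr : irreflexive adj }.

Definition iso (G1 G2 : sgraph) : bool :=
  [exists f : {ffun G1 -> G2},
    [&& injectiveb f, [forall y, y \in codom f] &
      [forall x, forall y, adj (f x) (f y) == adj x y]]].

Lemma isoP (G1 G2 : sgraph) :
  reflect (exists2 f : G1 -> G2,
             bijective f & forall x y, adj (f x) (f y) = adj x y)
          (iso G1 G2).
Proof.
apply: (iffP existsP) => [[f /and3P[/injectiveP f_inj /forallP f_surj]]|].
  move=> /'forall_'forall_eqP f_adj; exists f => //.
  apply: inj_card_bij => //; rewrite -(card_codom f_inj).
  by apply/subset_leq_card/subsetP=> y _; apply: f_surj.
move=> [f [g fK gK] f_adj]; exists [ffun x => f x]; apply/and3P; split.
- by apply/injectiveP => x y; rewrite !ffunE => /(can_inj fK).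
- apply/forallP => y; apply/codomP; exists (g y).
  by rewrite ffunE gK.
- by apply/'forall_'forall_eqP => x y; rewrite !ffunE f_adj.
Qed.

Section Graph.
Variable G : sgraph.

Definition edges : {set {set G}} :=
  [set e | [exists u, exists v, adj u v && (e == [set u; v])]].

Definition deg (x : G) : nat := #|[set y | adj x y]|.

(* The default value #|G| exceeds every degree, so it only matters for the
   graph without vertices. *)
Definition min_deg : nat := \big[minn/#|G|]_(x : G) deg x.

Definition edge_deg (e : {set G}) : nat := \sum_(x in e) deg x - 2.

Definition del_rel (e : {set G}) : rel G :=
  fun x y => adj x y && ([set x; y] != e).

Lemma del_sym e : symmetric (del_rel e).
Proof. by move=> x y; rewrite /del_rel adj_sym setUC. Qed.

Lemma del_irr e : irreflexive (del_rel e).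
Proof. by move=> x; rewrite /del_rel adj_irr. Qed.

Definition del_edge (e : {set G}) : sgraph := SGraph (del_sym e) (del_irr e).

Definition induced_rel (A : {set G}) : rel {x : G | x \in A} :=
  fun x y => adj (val x) (val y).

Lemma induced_sym A : symmetric (@induced_rel A).
Proof. by move=> x y; rewrite /induced_rel adj_sym. Qed.

Lemma induced_irr A : irreflexive (@induced_rel A).
Proof. by move=> x; rewrite /induced_rel adj_irr. Qed.

Definition induced (A : {set G}) : sgraph :=
  SGraph (@induced_sym A) (@induced_irr A).

Definition component (x : G) : sgraph :=
  induced [set y | connect (@adj G) x y].

Definition connected_graph : Prop :=
  0 < #|G| /\ forall x y : G, connect (@adj G) x y.

(* At least two components; the graph without vertices is neither connected
   nor disconnected. *)
Definition disconnected_graph : Prop :=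
  exists x y : G, ~~ connect (@adj G) x y.

End Graph.

(* Cards are represented by concrete graphs and compared by [ecard_eq], so a
   multiset of da-ecards is a sequence whose multiplicities are counted up to
   isomorphism. *)
Definition da_ecard : Type := (sgraph * nat)%type.

Definition ecard_eq (c d : da_ecard) : bool := iso c.1 d.1 && (c.2 == d.2).

Definition da_edeck (G : sgraph) : seq da_ecard :=
  [seq (del_edge e, edge_deg e) | e <- enum (edges G)].

Definition mult (c : da_ecard) (M : seq da_ecard) : nat :=
  count (ecard_eq c) M.

Definition sub_deck (M D : seq da_ecard) : Prop :=
  forall c, mult c M <= mult c D.

Definition determines (M : seq da_ecard) (G : sgraph) : Prop :=
  sub_deck M (da_edeck G) /\
  forall G' : sgraph, ~~ iso G' G -> ~ sub_deck M (da_edeck G').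

(* [dern] as a relation: no such k exists when the full da-edeck of G does not
   determine G. *)
Definition is_dern (G : sgraph) (k : nat) : Prop :=
  (exists2 M, size M = k & determines M G) /\
  forall M, determines M G -> k <= size M.

(* Main.v *)
Require Import Defs.
From mathcomp Require Import all_boot.
From mathcomp Require Import zify.
From Stdlib Require Import Classical.

(** Counting vertices by degree shows that isomorphic edge-cards of H come from
    edges whose ends have the same pair of degrees {a, b}, 3 <= a <= b; hence
    every edge of G joins a vertex of degree a to one of degree b.

    Suppose two edges of G' give da-ecards of G.  Each card is G minus an edge
    u v (deg u = a, deg v = b), and G' arises from it by adding an edge x y
    with deg x + deg y = a + b.  If {x, y} = {u, v} then G' is G.  Otherwise the
    degrees leave two possibilities: b = a + 1, x = u, and y another vertex of
    original degree a; or b = a + 2, and x, y both of original degree a.  In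
    either case deleting from G' an edge other than x y leaves two adjacent
    vertices whose degrees are impossible in a card of G, because a >= 3
    provides enough neighbours.  So any two da-ecards of G determine G. *)

Set Implicit Arguments.
Unset Strict Implicit.
Unset Printing Implicit Defensive.

(** * Edges, neighbours and degrees *)

Lemma eq_set2 (T : finType) (z w x y : T) :
  ([set z; w] == [set x; y]) =
  ((z == x) && (w == y)) || ((z == y) && (w == x)).
Proof.
apply/eqP/orP => [E|[/andP[/eqP-> /eqP->] | /andP[/eqP-> /eqP->]] //]; last first.
  by rewrite setUC.
have : z \in [set x; y] by rewrite -E set21.
have : w \in [set x; y] by rewrite -E set22.
have : x \in [set z; w] by rewrite E set21.
have : y \in [set z; w] by rewrite E set22.
rewrite !inE (eq_sym y z) (eq_sym y w) (eq_sym x z) (eq_sym x w).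
by case: (z == x); case: (w == y); case: (z == y); case: (w == x); auto.
Qed.

Section Graph.
Variable G : sgraph.
Implicit Types x y z u v : G.

Lemma adj_neq x y : adj x y -> x != y.
Proof. by apply: contraTneq => ->; rewrite adj_irr. Qed.

Lemma edgesP (e : {set G}) :
  reflect (exists x y, adj x y /\ e = [set x; y]) (e \in edges G).
Proof.
rewrite inE; apply: (iffP existsP) => [[x /existsP[y /andP[xy /eqP->]]]|].
  by exists x, y.
by move=> [x [y [xy ->]]]; exists x; apply/existsP; exists y; rewrite xy eqxx.
Qed.

(** Pigeonhole. Lower bounds on degrees are used through this: they supply an edge avoiding a few
    given vertices. *)
Lemma neighbor_outside x (s : seq G) :
  size s < deg x -> exists2 w, adj x w & w \notin s.
Proof.
move=> lt_s.
have /subsetPn[w] : ~~ ([set y | adj x y] \subset s).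
  apply/negP => /subset_leq_card; rewrite leqNgt => /negP; apply.
  exact: leq_ltn_trans (card_size s) lt_s.
by rewrite inE; exists w.
Qed.

Lemma deg_del_edge x y z : adj x y ->
  @deg (del_edge [set x; y]) z + ((z == x) + (z == y)) = deg z.
Proof.
(* The two ends play symmetric roles, so it suffices to treat a vertex other than the second end. *)
move=> xy; suff D (p q : G) : adj p q -> z != q ->
    @deg (del_edge [set p; q]) z + (z == p) = deg z.
  have [zy|zy] := eqVneq z y; last by rewrite addn0 D.
  have zx : z != x by rewrite zy eq_sym adj_neq.
  by rewrite (negbTE zx) setUC -(D y x) // 1?adj_sym // zy eqxx.
move=> {x y xy}; move: p q => x y xy zy.
case: eqVneq => [->|zx].
  rewrite /deg [in RHS](cardsD1 y) inE xy addnC; congr (_ + _).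
  apply: eq_card => w; rewrite !inE /adj /= /del_rel eq_set2 eqxx.
  by rewrite (negbTE (adj_neq xy)) /= orbF andbC.
rewrite addn0; apply: eq_card => w.
by rewrite !inE /adj /= /del_rel eq_set2 (negbTE zx) (negbTE zy) andbT.
Qed.

Lemma edge_deg_set2 x y : x != y -> edge_deg [set x; y] = deg x + deg y - 2.
Proof.
by move=> xy; rewrite /edge_deg big_setU1 ?big_set1 ?inE.
Qed.

Lemma min_deg_le x : min_deg G <= deg x.
Proof.
rewrite /min_deg; have: x \in index_enum G by exact: mem_index_enum.
elim: index_enum => // y s IH; rewrite inE big_cons geq_min => /orP[/eqP<-|/IH->].
  by rewrite leqnn.
by rewrite orbT.
Qed.

Lemma deg_gt0 x y : adj x y -> 0 < deg x.
Proof. by move=> xy; apply/card_gt0P; exists y; rewrite inE. Qed.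

End Graph.

(** * Isomorphisms, components and degrees *)

Lemma deg_embedding (G1 G2 : sgraph) (f : G1 -> G2) x :
  injective f -> (forall x y, adj (f x) (f y) = adj x y) ->
  (forall y, adj (f x) y -> y \in codom f) -> deg (f x) = deg x.
Proof.
move=> f_inj f_adj f_cl; rewrite /deg -[RHS](card_imset _ f_inj).
apply: eq_card => y; rewrite inE; apply/idP/imsetP => [xy|[z]].
  have /codomP[z yz] := f_cl _ xy; exists z => //.
  by rewrite inE -f_adj -yz.
by rewrite inE => xz ->; rewrite f_adj.
Qed.

Lemma deg_iso (G1 G2 : sgraph) (f : G1 -> G2) x :
  bijective f -> (forall x y, adj (f x) (f y) = adj x y) -> deg (f x) = deg x.
Proof.
move=> [g fK gK] f_adj; apply: deg_embedding => // [|y _]; first exact: can_inj fK.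
by rewrite -(gK y) codom_f.
Qed.

(** A component contains all neighbours of its vertices. *)
Lemma deg_component (G : sgraph) (x : G) (y : component x) :
  deg (val y) = deg y.
Proof.
apply: (@deg_embedding (component x) G val) => // [|z yz]; first exact: val_inj.
have xz : z \in [set z | connect (@adj G) x z].
  have := valP y; rewrite !inE => /connect_trans; apply; exact: connect1.
by rewrite -[z]/(val (exist _ z xz : component x)) codom_f.
Qed.

Lemma iso_sym (G1 G2 : sgraph) : iso G1 G2 -> iso G2 G1.
Proof.
move=> /isoP[f [g fK gK] f_adj]; apply/isoP; exists g; first by exists f.
by move=> x y; rewrite -f_adj !gK.
Qed.

Lemma iso_trans (G1 G2 G3 : sgraph) : iso G1 G2 -> iso G2 G3 -> iso G1 G3.
Proof.
move=> /isoP[f f_bij f_adj] /isoP[g g_bij g_adj].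
apply/isoP; exists (g \o f); first exact: bij_comp.
by move=> x y /=; rewrite g_adj f_adj.
Qed.

(** Lowering the value at [x] by one removes [x] from the level set exactly when the old value is
    [n]; likewise for [y]. *)
Lemma card_level_decr2 (T : finType) (f g : T -> nat) x y n : x != y ->
  (forall z, f z + ((z == x) + (z == y)) = g z) ->
  #|[set z | n <= f z]| + ((g x == n) + (g y == n)) = #|[set z | n <= g z]|.
Proof.
move=> xy fg; have yx : y != x by rewrite eq_sym.
have D h : #|[set z | n <= h z]| =
    (n <= h x) + ((n <= h y) + \sum_(z | (z != x) && (z != y)) (n <= h z)).
  rewrite -(bigD1 y yx) -(bigD1 (P := xpredT) x isT) -sum1dep_card big_mkcond.
  by apply: eq_bigr => z _; case: leqP.
rewrite !D (eq_bigr (fun z => nat_of_bool (n <= g z))) => [|z /andP[zx zy]].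
  have := fg x; have := fg y.
  by rewrite !eqxx (negbTE xy) (negbTE yx); lia.
by rewrite -fg (negbTE zx) (negbTE zy) !addn0.
Qed.

(* Counting the vertices of degree at least n, for every n, recovers from an
   edge-card of G the degrees of both ends of the deleted edge. *)
Lemma iso_del_edge_deg (G : sgraph) (x y z w : G) :
  adj x y -> adj z w -> iso (del_edge [set x; y]) (del_edge [set z; w]) ->
  (deg z = deg x /\ deg w = deg y) \/ (deg z = deg y /\ deg w = deg x).
Proof.
move=> xy zw /isoP[f f_bij f_adj].
(* Each side is the number of vertices of degree at least [n] lost by deleting one of the edges;
   isomorphic cards lose equally many. *)
have E n : (deg x == n) + (deg y == n) = (deg z == n) + (deg w == n).
  apply: (@addnI #|[set t | n <= @deg (del_edge [set x; y]) t]|).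
  rewrite (card_level_decr2 n (adj_neq xy) (fun t => deg_del_edge t xy)).
  rewrite -(card_level_decr2 n (adj_neq zw) (fun t => deg_del_edge t zw)).
  congr (_ + _).
  rewrite -(on_card_preimset (f := f)); last exact: onW_bij.
  by apply: eq_card => t; rewrite !inE (deg_iso _ f_bij f_adj).
have := E (deg x); have := E (deg y); lia.
Qed.

(** * Replacing the deleted edge of a biregular graph *)

Definition biregular (G : sgraph) (a b : nat) : Prop :=
  (forall z : G, deg z = a \/ deg z = b) /\
  (forall z w : G, adj z w ->
     (deg z = a /\ deg w = b) \/ (deg z = b /\ deg w = a)).

Lemma biregular_edge (G : sgraph) a b (e : {set G}) :
  biregular G a b -> e \in edges G ->
  exists p q, [/\ adj p q, e = [set p; q], deg p = a & deg q = b].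
Proof.
move=> [_ G_adj] /edgesP[x [y [xy ->]]].
case: (G_adj _ _ xy) => -[dx dy]; first by exists x, y.
by exists y, x; rewrite adj_sym setUC.
Qed.

(* [u] and [v] are the ends of the edge that was deleted from a biregular
   graph, [x y] is an edge put in its place, and [c] records the degrees in
   the biregular graph. *)
Record misplaced_edge (G : sgraph) (a b : nat) (x y u v : G) (c : G -> nat) :
    Prop := MisplacedEdge {
  mis_adj : adj x y;
  mis_sum : deg x + deg y = a + b;
  mis_u : c u = a;
  mis_v : c v = b;
  mis_neq : u != v;
  mis_range : forall z, c z = a \/ c z = b;
  mis_deg : forall z, c z + ((z == x) + (z == y)) = deg z + ((z == u) + (z == v));
  mis_edge : forall z w, adj z w -> [set z; w] != [set x; y] ->
    (c z = a /\ c w = b) \/ (c z = b /\ c w = a);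
  mis_moved : [set x; y] != [set u; v] }.

Lemma misplaced_edge_swap (G : sgraph) a b (x y u v : G) c :
  misplaced_edge a b x y u v c -> misplaced_edge a b y x u v c.
Proof.
case=> xy sum cu cv uv rng dg edg mv; split=> //.
- by rewrite adj_sym.
- by rewrite addnC.
- by move=> z; rewrite (addnC (_ == y)).
- by move=> z w; rewrite (setUC [set y]); apply: edg.
- by rewrite setUC.
Qed.

(** Everything moves to [G'] along the isomorphism of cards: [u] and [v] are the images of the ends
    of [e], and [c] reads degrees back in [G]. *)
Lemma misplaced_edge_of_card (G G' : sgraph) a b e e' :
  0 < a -> 0 < b -> biregular G a b -> e \in edges G -> e' \in edges G' ->
  ecard_eq (del_edge e, edge_deg e) (del_edge e', edge_deg e') ->
  ~~ iso G' G ->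
  exists x y u v c, e' = [set x; y] /\ @misplaced_edge G' a b x y u v c.
Proof.
move=> a_gt0 b_gt0 Gab eG /edgesP[x [y [xy e'E]]].
have [p [q [pq eE dp dq]]] := biregular_edge Gab eG.
rewrite {}e'E {}eE {e e' eG}.
move=> /andP[/= /isoP[f0 [g0 f0K g0K] f0_adj] /eqP]; rewrite !edge_deg_set2 ?adj_neq //.
have [f [g [fK gK f_del deg_f]]] : exists (f : G -> G') (g : G' -> G),
    [/\ cancel f g, cancel g f,
        forall z w, adj z w && ([set z; w] != [set p; q]) =
                    adj (f z) (f w) && ([set f z; f w] != [set x; y]) &
        forall z, @deg (del_edge [set x; y]) (f z) = @deg (del_edge [set p; q]) z].
  exists f0, g0; split=> // [z w|z]; first exact: esym (f0_adj z w).
  by apply: deg_iso f0_adj; exists g0.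
move=> sum nisoG; exists x, y, (f p), (f q), (fun z => deg (g z)); split=> //.
have f_eq z w : (f z == f w) = (z == w) by rewrite (inj_eq (can_inj fK)).
split=> //; rewrite ?fK //.
(* [edge_deg] subtracts 2 with truncation, so comparing the sums needs positive degrees. *)
- have := deg_gt0 xy; have : 0 < deg y by apply: (@deg_gt0 _ _ x); rewrite adj_sym.
  lia.
- by rewrite f_eq adj_neq.
- by move=> z; apply: (proj1 Gab).
(* Both sides equal the degree in the card plus the contributions of both edges. *)
- move=> z; rewrite -[z]gK fK !f_eq -(deg_del_edge (g z) pq).
  by rewrite -(deg_del_edge (f (g z)) xy) deg_f addnAC.
- move=> z w zw nzw; have := f_del (g z) (g w); rewrite !gK zw nzw.
  by move=> /andP[/(proj2 Gab)].
(* If the new edge sat in the old place, [f] would be an isomorphism from [G] to [G']. *)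
- apply: contraNN nisoG => /eqP E; apply/iso_sym/isoP; exists f; first by exists g.
  move=> z w; have := f_del z w; rewrite E !eq_set2 !f_eq -eq_set2.
  case: (boolP ([set z; w] == [set p; q])); last by rewrite !andbT.
  rewrite eq_set2 => /orP[/andP[/eqP-> /eqP->]|/andP[/eqP-> /eqP->]] _;
    [|rewrite adj_sym [RHS]adj_sym]; rewrite pq.
  all: move: E => /eqP; rewrite eq_set2.
  all: by move=> /orP[/andP[/eqP<- /eqP<-]|/andP[/eqP<- /eqP<-]] //; rewrite adj_sym.
Qed.

(** * Uniqueness of the added edge *)

Lemma misplaced_edge_cases (G : sgraph) a b (x y u v : G) c :
  a <= b -> misplaced_edge a b x y u v c ->
  [\/ [/\ b = a.+1, x = u, y != u & y != v],
      [/\ b = a.+1, y = u, x != u & x != v] |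
      [/\ b = a.+2, [&& x != u, x != v, y != u & y != v], c x = a & c y = a]].
Proof.
move=> ab [xy sum cu cv uv rng dg _]; rewrite eq_set2.
(* Disjoint pairs give [c x + c y + 2 = a + b], hence [b = a.+2]. Sharing only [u] gives [c = b - 1]
   at the other new end, hence [b = a.+1]; sharing only [v] would give [c = a - 1] there, which is
   impossible. *)
have := dg x; have := dg y; have := rng x; have := rng y.
rewrite !eqxx (eq_sym y x) (negbTE (adj_neq xy)).
have [xu|xu] := eqVneq x u; have [yu|yu] := eqVneq y u;
  have [xv|xv] := eqVneq x v; have [yv|yv] := eqVneq y v => /=;
  try (by move: xy uv; subst; rewrite ?eqxx ?adj_irr).
all: try (subst x); try (subst y).
all: move=> *; try (exfalso; lia).
- by apply: Or31; split=> //; lia.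
- by apply: Or32; split=> //; lia.
- by apply: Or33; split=> //; lia.
Qed.

(** Degrees and [c] differ only at [y], which gained the new edge, and at [v], which lost the old
    one; at [u] the two changes cancel. *)
Lemma misplaced_succ_deg (G : sgraph) a (u y v : G) c :
  y != u -> y != v -> misplaced_edge a a.+1 u y u v c ->
  [/\ deg u = a, deg y = a.+1, c y = a, deg v = a &
      forall z, z != y -> z != v -> c z = deg z].
Proof.
move=> yu yv [_ sum cu cv uv _ dg _ _].
have := dg u; have := dg y; have := dg v; rewrite !eqxx cu cv.
rewrite (negbTE uv) (negbTE yu) (negbTE yv) [u == y]eq_sym [v == u]eq_sym.
rewrite [v == y]eq_sym (negbTE uv) (negbTE yu) (negbTE yv) => Dv Dy Du.
have [-> -> -> ->] : [/\ deg u = a, deg y = a.+1, c y = a & deg v = a].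
  by move: (deg u) (deg y) (deg v) (c y) sum Dv Dy Du; clear; split; lia.
split=> // z zy zv; have := dg z; rewrite (negbTE zy) (negbTE zv) !addn0.
exact: addIn.
Qed.

Lemma misplaced_succ_hub (G : sgraph) a (u y v u' y' v' : G) c c' :
  2 < a -> y != u -> y != v -> y' != u' -> y' != v' ->
  misplaced_edge a a.+1 u y u v c -> misplaced_edge a a.+1 u' y' u' v' c' ->
  y = y'.
Proof.
move=> a_gt2 yu yv yu' yv' m m'; apply/eqP; apply: contraT => yy'.
have [du dy cy dv cE] := misplaced_succ_deg yu yv m.
have [du' dy' cy' dv' cE'] := misplaced_succ_deg yu' yv' m'.
(* The first card has [c y = a] and so forces [c w = a.+1]; in the second card both ends of the edge
   [y w] then have [c' = a.+1], a contradiction. *)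
have [|w yw] := @neighbor_outside _ y [:: u; v; y']; first by rewrite dy.
rewrite !inE !negb_or => /and3P[wu wv wy'].
have wy : w != y by rewrite eq_sym adj_neq.
have cw : deg w = a.+1.
  have := mis_edge m yw; rewrite eq_set2 (negbTE yu) (negbTE wu) andbF cy (cE w) //.
  by case=> // -[] // /n_Sn.
have deg_b z : z != y' -> deg z = a.+1 -> c' z = a.+1.
  move=> zy' dz; rewrite cE' //; apply: contra_eqN dz => /eqP->.
  by rewrite dv' neq_ltn leqnn.
have := mis_edge m' yw; rewrite eq_set2 (negbTE yy') (negbTE wy') andbF.
by rewrite !deg_b // => -[] // -[] => [/esym/n_Sn|_ /esym/n_Sn].
Qed.

(** If [u' != v], the edge [u' y] survives in the first card and joins two vertices with [c = a]. *)
Lemma misplaced_succ_tip (G : sgraph) a (u y v u' v' : G) c c' :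
  y != u -> y != v -> y != u' -> y != v' -> u != u' ->
  misplaced_edge a a.+1 u y u v c -> misplaced_edge a a.+1 u' y u' v' c' ->
  u' = v.
Proof.
move=> yu yv yu' yv' uu' m m'; apply/eqP; apply: contraT => u'v.
have [du dy cy dv cE] := misplaced_succ_deg yu yv m.
have [du' _ _ _ _] := misplaced_succ_deg yu' yv' m'.
have := mis_adj m'; rewrite adj_sym => /(mis_edge m).
have u'y : u' != y by rewrite eq_sym.
rewrite eq_set2 (negbTE yu) eqxx [u' == u]eq_sym (negbTE uu') cy (cE u') // du'.
by case=> // -[] => [_ /n_Sn|/n_Sn].
Qed.

Lemma misplaced_edge_unique_succ (G : sgraph) a (u y v u' y' v' : G) c c' :
  2 < a -> y != u -> y != v -> y' != u' -> y' != v' ->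
  misplaced_edge a a.+1 u y u v c -> misplaced_edge a a.+1 u' y' u' v' c' ->
  [set u; y] = [set u'; y'].
Proof.
move=> a_gt2 yu yv yu' yv' m m'.
have yy' := misplaced_succ_hub a_gt2 yu yv yu' yv' m m'; subst y'.
have [->//|uu'] := eqVneq u u'; exfalso.
have E := misplaced_succ_tip yu yv yu' yv' uu' m m'.
have E' : u = v' by apply: (misplaced_succ_tip yu' yv' yu yv _ m' m); rewrite eq_sym.
subst u' v'.
have [du dy cy dv cE] := misplaced_succ_deg yu yv m.
have [_ _ _ _ cE'] := misplaced_succ_deg yu' yv' m'.
(* The edge [v z] lies in both cards. As [c v = a.+1] and [c' v = a], it demands [c z = a] and
   [c' z = a.+1], yet both equal [deg z]. *)
have [|z vz] := @neighbor_outside _ v [:: y; u]; first by rewrite dv.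
rewrite !inE negb_or => /andP[zy zu].
have zv : z != v by rewrite eq_sym adj_neq.
have := mis_edge m vz; rewrite eq_set2 (eq_sym v u) (negbTE uu') (negbTE zu) andbF.
have := mis_edge m' vz; rewrite eq_set2 (negbTE zy) (negbTE zv) !andbF.
rewrite (mis_v m) (mis_u m') (cE z) // (cE' z) // => -[] // [H1 H2] [] // [H3 H4].
all: by move: H1 H2 H3 H4; clear; lia.
Qed.

(** The new edge raises [x] and [y] from [a], and the lost edge lowers [v] from [a.+2]; [u] drops
    below [a], and all other vertices keep degree [a] or [a.+2]. *)
Lemma misplaced_succ2_deg (G : sgraph) a (x y u v : G) c :
  [&& x != u, x != v, y != u & y != v] -> c x = a -> c y = a ->
  misplaced_edge a a.+2 x y u v c ->
  forall z, (deg z == a.+1) = [|| z == x, z == y | z == v].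
Proof.
move=> /and4P[xu xv yu yv] cx cy [/adj_neq xy _ cu cv uv rng dg _ _] z.
move: (dg z) (rng z).
have [->|zx] := eqVneq z x.
  rewrite (negbTE xy) (negbTE xu) (negbTE xv) cx; clear; lia.
have [->|zy] := eqVneq z y.
  rewrite (negbTE yu) (negbTE yv) cy; clear; lia.
have [->|zv] := eqVneq z v.
  rewrite eq_sym (negbTE uv) cv; clear; lia.
have [->|zu] := eqVneq z u; first by rewrite cu; clear; lia.
by clear; lia.
Qed.

Lemma misplaced_edge_unique_succ2 (G : sgraph) a (x y u v x' y' u' v' : G) c c' :
  1 < a -> [&& x != u, x != v, y != u & y != v] ->
  [&& x' != u', x' != v', y' != u' & y' != v'] ->
  c x = a -> c y = a -> c' x' = a -> c' y' = a ->
  misplaced_edge a a.+2 x y u v c -> misplaced_edge a a.+2 x' y' u' v' c' ->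
  [set x; y] = [set x'; y'].
Proof.
move=> a_gt1 xyuv xyuv' cx cy cx' cy' m m'.
have S := misplaced_succ2_deg xyuv cx cy m.
have S' := misplaced_succ2_deg xyuv' cx' cy' m'.
have SS z : [|| z == x, z == y | z == v] = [|| z == x', z == y' | z == v'].
  by rewrite -S S'.
apply/eqP; apply: contraT; rewrite eq_set2 => neq.
have xy := adj_neq (mis_adj m); have xy' := adj_neq (mis_adj m').
(* The three vertices of degree [a.+1] are the same for both cards, so if the edges differ then [v']
   is [x] or [y]. *)
wlog E : x y m xyuv cx cy S SS neq xy / y = v'.
  move=> W; have := SS v'; rewrite eqxx !orbT.
  case/or3P => /eqP E; last first.
  - subst v'; case/and4P: xyuv => _ /negbTE xv _ /negbTE yv.
    have := SS x; have := SS y; rewrite !eqxx xv yv /= !orbT !orbF.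
    case/esym/orP=> /eqP H1; case/esym/orP=> /eqP H2;
      by move: neq xy; rewrite ?H1 ?H2 !eqxx ?orbT.
  - by apply: (W x y).
  - apply: (W y x) => //; first exact: misplaced_edge_swap.
    + by case/and4P: xyuv => -> -> -> ->.
    + by move=> z; rewrite S orbCA.
    + by move=> z; rewrite orbCA.
    + by apply: contraNN neq => /orP[]/andP[-> ->]; rewrite ?orbT.
    + by rewrite eq_sym.
(* For the edge [v' w], the first card gives [c w = a.+2], hence [deg w = a.+2]; the second gives
   [c' w = a], hence [deg w <= a.+1]. *)
subst y; have [] := @neighbor_outside _ v' [:: x; v].
  by have /eqP-> : deg v' == a.+1; [rewrite S eqxx orbT | exact: a_gt1].
move=> w vw; rewrite !inE negb_or => /andP[wx wv].
have wv' : w != v' by rewrite eq_sym adj_neq.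
have := mis_edge m vw; rewrite eq_set2 (negbTE wx) (eq_sym v' x) (negbTE xy) !andbF cy.
have := mis_edge m' vw; case/and4P: xyuv' => _ xv' _ yv'.
rewrite eq_set2 (eq_sym v' x') (eq_sym v' y') (negbTE xv') (negbTE yv') (mis_v m').
have := mis_deg m w; have := mis_deg m' w.
rewrite (negbTE wx) (negbTE wv) (negbTE wv').
have wu : c w = a.+2 -> w != u.
  move=> cw; apply: contra_eqN cw => /eqP->.
  by rewrite (mis_u m) neq_ltn ltnS leqnSn.
have w1 : (w == x') + (w == y') <= 1.
  by case: eqVneq => [->|_]; rewrite ?(negbTE xy') // leq_b1.
move=> H1 H2 [] // [H3 H4] [] // [H5 H6].
all: by move: H1 H2 H3 H4 H5 H6 w1 wu; clear; lia.
Qed.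

Lemma misplaced_edge_unique (G : sgraph) a b (x y u v x' y' u' v' : G) c c' :
  2 < a -> a <= b ->
  misplaced_edge a b x y u v c -> misplaced_edge a b x' y' u' v' c' ->
  [set x; y] = [set x'; y'].
Proof.
move=> a_gt2 ab m m'.
case: (misplaced_edge_cases ab m); case: (misplaced_edge_cases ab m').
all: case=> ? ? ? ?; case=> ? ? ? ?; subst; try lia.
- exact: misplaced_edge_unique_succ m m'.
- rewrite (setUC [set x']).
  exact: misplaced_edge_unique_succ m (misplaced_edge_swap m').
- rewrite (setUC [set x]).
  exact: misplaced_edge_unique_succ (misplaced_edge_swap m) m'.
- rewrite (setUC [set x]) (setUC [set x']).
  exact: misplaced_edge_unique_succ (misplaced_edge_swap m) (misplaced_edge_swap m').
- by apply: (misplaced_edge_unique_succ2 _ _ _ _ _ _ _ m m') => //; exact: ltnW.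
Qed.

(** * Sub-decks of two cards *)

Lemma ecard_eq_refl c : ecard_eq c c.
Proof.
by rewrite /ecard_eq eqxx andbT; apply/isoP; exists id => //; exists id.
Qed.

Lemma ecard_eq_sym c d : ecard_eq c d -> ecard_eq d c.
Proof. by move=> /andP[/iso_sym cd /eqP E]; rewrite /ecard_eq cd E eqxx. Qed.

Lemma ecard_eq_trans c d e : ecard_eq c d -> ecard_eq d e -> ecard_eq c e.
Proof.
by move=> /andP[cd /eqP E] /andP[de /eqP E']; rewrite /ecard_eq (iso_trans cd de) E E' /=.
Qed.

Lemma mult_da_edeck (G : sgraph) c :
  mult c (da_edeck G) =
  #|[set e in edges G | ecard_eq c (del_edge e, edge_deg e)]|.
Proof.
rewrite /mult /da_edeck count_map -size_filter cardE.
rewrite /enum_mem -filter_predI; congr size.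
by apply: eq_filter => e; rewrite /= !inE andbC.
Qed.

(** Equal cards have multiplicity two and so need two edges; unequal cards come from different edges
    anyway. *)
Lemma sub_deck_pair (c1 c2 : da_ecard) (G : sgraph) :
  sub_deck [:: c1; c2] (da_edeck G) ->
  exists e1 e2, [/\ e1 \in edges G, e2 \in edges G, e1 != e2,
    ecard_eq c1 (del_edge e1, edge_deg e1) &
    ecard_eq c2 (del_edge e2, edge_deg e2)].
Proof.
move=> sub; have := sub c1; have := sub c2; rewrite !mult_da_edeck /mult /=.
rewrite !ecard_eq_refl; case: (boolP (ecard_eq c1 c2)) => [c12 _ /card_gt1P|n12].
  move=> [e1 [e2 [] /setIdP[e1G c1e] /setIdP[e2G c2e] ne]]; exists e1, e2; split=> //.
  exact: ecard_eq_trans (ecard_eq_sym c12) c2e.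
rewrite addn0 => /(leq_trans (leq_addl _ _))/card_gt0P[e2 /setIdP[e2G c2e]].
move=> /card_gt0P[e1 /setIdP[e1G c1e]]; exists e1, e2; split=> //.
apply: contraNneq n12 => E; rewrite E in c1e.
exact: ecard_eq_trans c1e (ecard_eq_sym c2e).
Qed.

Lemma biregular_determined (G : sgraph) a b :
  2 < a -> a <= b -> biregular G a b -> 1 < #|edges G| ->
  exists2 M, size M = 2 & determines M G.
Proof.
move=> a_gt2 ab Gab; rewrite cardE.
case E: (enum (edges G)) => [|e1 [|e2 s]] // _.
have e1G : e1 \in edges G by rewrite -mem_enum E !inE eqxx.
have e2G : e2 \in edges G by rewrite -mem_enum E !inE eqxx orbT.
(* Taking the first two edges makes the pair a prefix of the da-edeck. *)
exists [:: (del_edge e1, edge_deg e1); (del_edge e2, edge_deg e2)] => //; split.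
  by move=> c; rewrite /mult /da_edeck E /= addn0 addnA leq_addr.
move=> G' nisoG /sub_deck_pair[f1 [f2 [f1G f2G /eqP ne E1 E2]]].
have a_gt0 : 0 < a by lia.
have b_gt0 : 0 < b by lia.
have [x [y [u [v [c [f1E m]]]]]] :=
  misplaced_edge_of_card a_gt0 b_gt0 Gab e1G f1G E1 nisoG.
have [x' [y' [u' [v' [c' [f2E m']]]]]] :=
  misplaced_edge_of_card a_gt0 b_gt0 Gab e2G f2G E2 nisoG.
by case: ne; rewrite f1E f2E; apply: misplaced_edge_unique m m'.
Qed.

(** * From components to the whole graph, and existence of the minimum *)

Lemma component_iso_deg (G H : sgraph) (x y : G) :
  iso (component x) H -> adj x y ->
  exists p q : H, [/\ adj p q, deg p = deg x & deg q = deg y].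
Proof.
move=> /isoP[f f_bij f_adj] xy.
have xx : x \in [set y | connect (@adj G) x y] by rewrite inE connect0.
have xy' : y \in [set y | connect (@adj G) x y] by rewrite inE connect1.
exists (f (exist _ x xx)), (f (exist _ y xy')).
by rewrite f_adj !(deg_iso _ f_bij f_adj) -!deg_component.
Qed.

Lemma component_iso_deg1 (G H : sgraph) (x : G) :
  iso (component x) H -> exists p : H, deg p = deg x.
Proof.
move=> /isoP[f f_bij f_adj].
have xx : x \in [set y | connect (@adj G) x y] by rewrite inE connect0.
by exists (f (exist _ x xx)); rewrite (deg_iso _ f_bij f_adj) -deg_component.
Qed.

Lemma card_edges_gt1 (G : sgraph) (x : G) : 1 < deg x -> 1 < #|edges G|.
Proof.
move=> /card_gt1P[y [z []]]; rewrite !inE => xy xz yz.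
apply/card_gt1P; exists [set x; y], [set x; z]; split.
- by apply/edgesP; exists x, y.
- by apply/edgesP; exists x, z.
- by rewrite eq_set2 eqxx (negbTE yz) (negbTE (adj_neq xz)).
Qed.

(** [determines] quantifies over all graphs, so the least size is found by strong induction with
    excluded middle. *)
Lemma is_dern_le (G : sgraph) n :
  (exists2 M, size M = n & determines M G) -> exists2 k, is_dern G k & k <= n.
Proof.
elim/ltn_ind: n => n IH nM.
case: (classic (exists2 M, determines M G & size M < n)) => [[M MG Mn]|noM].
  have [|k Gk kM] := IH _ Mn; first by exists M.
  by exists k => //; apply: leq_trans kM (ltnW Mn).
exists n => //; split=> // M MG; rewrite leqNgt; apply/negP => Mn.
by apply: noM; exists M.
Qed.

Theorem theorem4p2 (G H : sgraph)
  (G_disc : disconnected_graph G)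
  (H_conn : connected_graph H)
  (G_comp : forall x : G, iso (component x) H)
  (H_cards : forall e f : {set H},
     e \in edges H -> f \in edges H -> iso (del_edge e) (del_edge f))
  (H_deg : 3 <= min_deg H) :
  exists2 k, is_dern G k & k <= 2.
Proof.
have degG (x : G) : 2 < deg x.
  have [p <-] := component_iso_deg1 (G_comp x).
  exact: leq_trans H_deg (min_deg_le p).
have [x0 _] := G_disc.
have [y0 xy0 _] := @neighbor_outside _ x0 [::] (ltn_trans (isT : 0 < 2) (degG x0)).
have [p [q [pq dp dq]]] := component_iso_deg (G_comp x0) xy0.
(* Every edge of [G] is a copy of an edge of [H], and the cards of [H] are isomorphic, so its ends
   have the same pair of degrees as [x0] and [y0]. *)
have G_adj (z w : G) : adj z w ->
    (deg z = deg x0 /\ deg w = deg y0) \/ (deg z = deg y0 /\ deg w = deg x0).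
  move=> zw; have [r [s [rs <- <-]]] := component_iso_deg (G_comp z) zw.
  rewrite -dp -dq; apply: iso_del_edge_deg => //.
  by apply: H_cards; apply/edgesP; [exists p, q | exists r, s].
have G_deg (z : G) : deg z = deg x0 \/ deg z = deg y0.
  have [w zw _] := @neighbor_outside _ z [::] (ltn_trans (isT : 0 < 2) (degG z)).
  by case: (G_adj _ _ zw) => -[]; auto.
apply/is_dern_le; have E := card_edges_gt1 (ltnW (degG x0)).
(* The smaller of the two degrees takes the role of [a]. *)
have [le_xy|/ltnW le_yx] := leqP (deg x0) (deg y0).
  exact: biregular_determined (degG x0) le_xy _ E.
apply: biregular_determined (degG y0) le_yx _ E; split=> [z|z w zw].
  by case: (G_deg z); auto.
by case: (G_adj _ _ zw); auto.
Qed.
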